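(* Let $\alpha>-1$ be a fixed real number different from $-\frac{6}{7}$. The approximation operator relative to the enriched finite element $\mathcal{C}_\alpha$, $$\Pi^{\mathrm{enr}}_{2,\mathcal{C}_\alpha}:C(T)\to\mathbb{P}_2(T),\qquad f\mapsto\sum_{j=1}^{3}\left(\mathcal{I}^{\mathrm{CR}}_j(f)\,\psi_j+\mathcal{F}^{\mathrm{enr}}_{j,\alpha}(f)\,\zeta_j\right),$$ reproduces all polynomials of $\mathbb{P}_2(T)$ (i.e. $\Pi^{\mathrm{enr}}_{2,\mathcal{C}_\alpha}[p]=p$ for every $p\in\mathbb{P}_2(T)$) and satisfies, for every $f\in C(T)$, $$\mathcal{I}^{\mathrm{CR}}_j\left(\Pi^{\mathrm{enr}}_{2,\mathcal{C}_\alpha}[f]\right)=\mathcal{I}^{\mathrm{CR}}_j(f),\qquad \mathcal{F}^{\mathrm{enr}}_{j,\alpha}\left(\Pi^{\mathrm{enr}}_{2,\mathcal{C}_\alpha}[f]\right)=\mathcal{F}^{\mathrm{enr}}_{j,\alpha}(f),\qquad j=1,2,3.$$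
   Context: Let $T\subset\mathbb{R}^2$ be a nondegenerate triangle with vertices $\boldsymbol{v}_1,\boldsymbol{v}_2,\boldsymbol{v}_3$, with the convention $\boldsymbol{v}_4=\boldsymbol{v}_1$, $\boldsymbol{v}_5=\boldsymbol{v}_2$. $C(T)$ is the space of continuous real-valued functions on $T$ and $\mathbb{P}_2(T)$ is the space of real bivariate polynomials of total degree at most $2$, regarded as functions on $T$. Let $\boldsymbol{m}_1=\frac{\boldsymbol{v}_2+\boldsymbol{v}_3}{2}$, $\boldsymbol{m}_2=\frac{\boldsymbol{v}_3+\boldsymbol{v}_1}{2}$, $\boldsymbol{m}_3=\frac{\boldsymbol{v}_1+\boldsymbol{v}_2}{2}$. For $j=1,2,3$ define $$\mathcal{I}^{\mathrm{CR}}_j(f)=\int_0^1 f\left(t\boldsymbol{v}_{j+1}+(1-t)\boldsymbol{v}_{j+2}\right)dt,\qquad \mathcal{F}^{\mathrm{enr}}_{j,\alpha}(f)=\int_0^1 w_\alpha(t)\, f\left(t\boldsymbol{v}_j+(1-t)\boldsymbol{m}_j\right)dt,\qquad w_\alpha(t)=t^\alpha(1-t)^\alpha.$$ The triple $\mathcal{C}_\alpha=(T,\mathbb{P}_2(T),\{\mathcal{I}^{\mathrm{CR}}_j,\mathcal{F}^{\mathrm{enr}}_{j,\alpha}: j=1,2,3\})$ is a finite element (the six functionals are unisolvent on $\mathbb{P}_2(T)$). The basis functions associated to $\mathcal{C}_\alpha$ are the basis $\{\psi_i,\zeta_i: i=1,2,3\}$ of $\mathbb{P}_2(T)$ satisfying,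 for $i,j=1,2,3$, $$\mathcal{I}^{\mathrm{CR}}_j(\psi_i)=\delta_{ij},\quad \mathcal{F}^{\mathrm{enr}}_{j,\alpha}(\psi_i)=0,\qquad \mathcal{I}^{\mathrm{CR}}_j(\zeta_i)=0,\quad \mathcal{F}^{\mathrm{enr}}_{j,\alpha}(\zeta_i)=\delta_{ij}.$$ *)

(* Defs.v *)
From HB Require Import structures.
From mathcomp Require Import all_boot all_order all_algebra.
From mathcomp Require Import all_classical all_reals all_analysis.
(* The notations of mpoly clash with those of MathComp-Analysis. *)
From mathcomp Require Import -(notations) mpoly.

Set Implicit Arguments.
Unset Strict Implicit.
Unset Printing Implicit Defensive.

Import Order.TTheory GRing.Theory Num.Theory.
Import numFieldNormedType.Exports.

Local Open Scope classical_set_scope.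
Local Open Scope ring_scope.

(* The vertices v_1, v_2, v_3 are v 0, v 1, v 2; the addition of 'I_3 is taken
   modulo 3, so that v (j + 1) and v (j + 2%:R) follow the convention v_4 = v_1,
   v_5 = v_2.

   A function on the triangle T is a function on R^2 of which only the values
   on T matter: continuity, membership in P_2(T), linear relations and equality
   are all relative to T. *)

Section EnrichedElement.
Variable R : realType.
Local Notation plane := 'rV[R]_2.
Local Notation mu := (@lebesgue_measure R).
Implicit Types (v : 'I_3 -> plane) (f g : plane -> R) (T : set plane).

Definition nondegenerate_triangle v : bool :=
  row_free (col_mx (v 1 - v 0) (v 2%:R - v 0)).

Definition triangle v : set plane :=
  [set x | exists c : 'I_3 -> R,
    [/\ forall i, 0 <= c i, \sum_i c i = 1 & x = \sum_i c i *: v i]].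

Definition contOn T f : Prop := {within T, continuous f}.

Definition eqOn T f g : Prop := {in T, f =1 g}.

(* msize is the total degree plus one (and 0 for the zero polynomial). *)
Definition P2 T : set (plane -> R) :=
  [set f | exists p : mpoly 2 R, (msize p <= 3)%N /\
    eqOn T f (fun x => meval (fun i => x 0 i) p)].

Definition midpoint v (j : 'I_3) : plane :=
  2%:R^-1 *: (v (j + 1) + v (j + 2%:R)).

Definition I_CR v (j : 'I_3) f : R :=
  \int[mu]_(t in `[0, 1]) f (t *: v (j + 1) + (1 - t) *: v (j + 2%:R)).

(* For a < 0 the weight is infinite at 0 and 1, where powR takes the value 0;
   the two endpoints are negligible for the integral below. *)
Definition weight (a t : R) : R := t `^ a * (1 - t) `^ a.

Definition F_enr v (a : R) (j : 'I_3) f : R :=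
  \int[mu]_(t in `[0, 1])
    (weight a t * f (t *: v j + (1 - t) *: midpoint v j)).

Definition comb (psi zeta : 'I_3 -> plane -> R) (a b : 'I_3 -> R) : plane -> R :=
  fun x => \sum_j (a j * psi j x + b j * zeta j x).

Definition is_basis_P2 T (psi zeta : 'I_3 -> plane -> R) : Prop :=
  [/\ forall i, P2 T (psi i) /\ P2 T (zeta i),
      forall a b, eqOn T (comb psi zeta a b) (fun=> 0) ->
        forall i, a i = 0 /\ b i = 0
    & forall f, P2 T f -> exists a b, eqOn T f (comb psi zeta a b)].

Definition is_basis_functions v (a : R) (psi zeta : 'I_3 -> plane -> R) : Prop :=
  is_basis_P2 (triangle v) psi zeta /\
  forall i j : 'I_3,
    [/\ I_CR v j (psi i) = (i == j)%:R, F_enr v a j (psi i) = 0,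
        I_CR v j (zeta i) = 0 & F_enr v a j (zeta i) = (i == j)%:R].

(* The basis functions of C_a. They are selected by their characterization,
   which determines them on the triangle; if it had no solution, the value
   would be the zero families. *)
Definition basis_functions v (a : R) :
    ('I_3 -> plane -> R) * ('I_3 -> plane -> R) :=
  xget (fun _ _ => 0, fun _ _ => 0)
    [set b | is_basis_functions v a b.1 b.2].

Definition psi_enr v (a : R) : 'I_3 -> plane -> R := (basis_functions v a).1.
Definition zeta_enr v (a : R) : 'I_3 -> plane -> R := (basis_functions v a).2.

Definition Pi_enr v (a : R) f : plane -> R :=
  comb (psi_enr v a) (zeta_enr v a)
    (fun j => I_CR v j f) (fun j => F_enr v a j f).

End EnrichedElement.

(* Main.v *)
Require Import Defs.
From HB Require Import structures.
From mathcomp Require Import all_boot all_order all_algebra.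
From mathcomp Require Import all_classical all_reals all_analysis.
From mathcomp Require Import measurable_realfun.
From mathcomp Require Import -(notations) mpoly.
From mathcomp Require Import ring lra.

Set Implicit Arguments.
Unset Strict Implicit.
Unset Printing Implicit Defensive.

Import Order.TTheory GRing.Theory Num.Theory.
Import numFieldNormedType.Exports.

Local Open Scope classical_set_scope.
Local Open Scope ring_scope.

(* In barycentric coordinates c every p in P_2(T) is a quadratic form
   sum_i a_i c_i^2 + b_i c_{i+1} c_{i+2}, and with A = int w t^2 and
   B = int w t(1-t) the functionals read
     I_j = (a_{j+1} + a_{j+2}) / 3 + b_j / 6,
     F_j = A (a_j + (a_{j+1} + a_{j+2} + b_j) / 4) + B (b_{j+1} + b_{j+2}) / 2.
   This circulant system splits into the equations for the sums over j, of
   determinant (8B - A) / 12, and those for the deviations from the mean, of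
   determinant (4B - 5A) / 24. Since (alpha + 2) B = (alpha + 1) A with B > 0,
   the first vanishes only for alpha = -6/7 and the second never, so that the
   dual basis exists; the theorem then is linear algebra. *)

(** * Indices modulo 3 and quadratic forms in three variables *)

Lemma sum3E (V : nmodType) (F : 'I_3 -> V) (j : 'I_3) :
  \sum_i F i = F j + F (j + 1) + F (j + 2%:R).
Proof.
transitivity (\sum_i F (j + i)).
  by rewrite (reindex_inj (addrI j)).
rewrite 3!big_ord_recl big_ord0 [X in _ + (_ + X)]addr0 addrA.
rewrite (_ : j + ord0 = j) ?addr0//.
by congr (_ + F _ + F _); congr (_ + _); apply: val_inj.
Qed.

Lemma shift3 (j : 'I_3) :
  [/\ j + 1 + 1 = j + 2%:R, j + 1 + 2%:R = j, j + 2%:R + 1 = j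
    & j + 2%:R + 2%:R = j + 1].
Proof.
by split; apply: val_inj; case: j => [[|[|[|]]]].
Qed.

(** The coefficient [b i] belongs to the edge opposite the vertex i, on which the coordinate [c i]
    vanishes. *)
Definition bquad {R : pzRingType} (a b c : 'I_3 -> R) : R :=
  \sum_i (a i * c i ^+ 2 + b i * (c (i + 1) * c (i + 2%:R))).

Lemma bquadE (R : comPzRingType) (a b c : 'I_3 -> R) (j : 'I_3) :
  bquad a b c =
    a j * c j ^+ 2 + a (j + 1) * c (j + 1) ^+ 2
    + a (j + 2%:R) * c (j + 2%:R) ^+ 2
    + b j * (c (j + 1) * c (j + 2%:R)) + b (j + 1) * (c j * c (j + 2%:R))
    + b (j + 2%:R) * (c j * c (j + 1)).
Proof.
rewrite /bquad (sum3E _ j); have [-> -> -> ->] := shift3 j; ring.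
Qed.

Lemma bquad_lin (R : comPzRingType) (k l : R) (a b a' b' c : 'I_3 -> R) :
  bquad (fun i => k * a i + l * a' i) (fun i => k * b i + l * b' i) c =
  k * bquad a b c + l * bquad a' b' c.
Proof. by rewrite !(bquadE _ _ _ 0); ring. Qed.

(** This turns a polynomial of degree at most 2, written as products of two linear forms in c, into
    the normal form. *)
Lemma bquad_mul (R : comPzRingType) (l m c : 'I_3 -> R) :
  (\sum_i c i * l i) * (\sum_i c i * m i) =
  bquad (fun i => l i * m i)
    (fun i => l (i + 1) * m (i + 2%:R) + l (i + 2%:R) * m (i + 1)) c.
Proof.
rewrite (bquadE _ _ _ 0) !(sum3E _ 0); have [-> -> -> ->] := shift3 0; ring.
Qed.

(** * Polynomials of degree at most 2 in barycentric coordinates *)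

Section Barycentric.
Variable R : realType.
Implicit Types (v : 'I_3 -> 'rV[R]_2) (f : 'rV[R]_2 -> R) (c : 'I_3 -> R).

(** Nonnegativity of c restricts the identity to the triangle, so that it depends only on the values
    of f there. *)
Definition bary_eq v f (a b : 'I_3 -> R) := forall c,
  (forall i, 0 <= c i) -> \sum_i c i = 1 ->
  f (\sum_i c i *: v i) = bquad a b c.

Definition evalrV (p : mpoly 2 R) (x : 'rV[R]_2) : R :=
  meval (fun i => x 0 i) p.

(** Where the c_i sum to 1, both the coordinates of the point and the constant 1 are linear forms in
    c. A monomial of degree at most 2, padded with factors 1, is therefore a product of two linear
    forms. *)
Lemma mpoly_bquad v (p : mpoly 2 R) : (msize p <= 3)%N ->
  exists a b, forall c, \sum_i c i = 1 ->
    evalrV p (\sum_i c i *: v i) = bquad a b c.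
Proof.
move=> p3.
have linE c k : (\sum_i c i *: v i) 0 k = \sum_i c i * v i 0 k.
  by rewrite summxE; apply: eq_bigr => i _; rewrite mxE.
have oneE c : \sum_i c i = 1 -> 1 = \sum_i c i * 1.
  by move=> c1; rewrite -[LHS]c1; apply: eq_bigr => i _; rewrite mulr1.
rewrite /evalrV; under eq_exists do under eq_exists do under eq_forall do
  rewrite mevalE.
(* The degree bound is moved to the list of monomials, so that it survives the induction on that
   list. *)
have : {in msupp p, forall m, (mdeg m < 3)%N}.
  by move=> m /msize_mdeg_lt /leq_trans; exact.
elim: (msupp p) => [|m s IH] sP.
  exists (fun=> 0), (fun=> 0) => c _.
  by rewrite big_nil /bquad big1// => i _; rewrite !mul0r addr0.
have {IH} [a [b IH]] : exists a b, forall c, \sum_i c i = 1 ->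
    \sum_(m <- s) mcoeff m p * \prod_i (\sum_j c j *: v j) 0 i ^+ m i
      = bquad a b c.
  by apply: IH => k ks; apply: sP; rewrite inE ks orbT.
have [l [k lk]] : exists l k : 'I_3 -> R, forall c, \sum_i c i = 1 ->
    \prod_i (\sum_j c j *: v j) 0 i ^+ m i =
    (\sum_i c i * l i) * (\sum_i c i * k i).
  have : (m ord0 + m (lift ord0 ord0) < 3)%N.
    by have := sP m (mem_head _ _); rewrite mdegE !big_ord_recl big_ord0 addn0.
  have prodE (x : 'rV[R]_2) : \prod_i x 0 i ^+ m i =
      x 0 ord0 ^+ m ord0 * x 0 (lift ord0 ord0) ^+ m (lift ord0 ord0).
    by rewrite !big_ord_recl big_ord0 mulr1.
  under eq_exists do under eq_exists do under eq_forall do rewrite prodE !linE.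
  case: (m ord0) => [|[|[|n0]]];
    case: (m (lift ord0 ord0)) => [|[|[|n1]]] //= _.
  - by exists (fun=> 1), (fun=> 1) => c c1; rewrite !expr0 -!oneE.
  - by exists (fun=> 1), (fun j => v j 0 (lift ord0 ord0)) => c c1;
      rewrite expr0 expr1 -oneE.
  - by exists (fun j => v j 0 (lift ord0 ord0)),
      (fun j => v j 0 (lift ord0 ord0)) => c c1; rewrite expr0 mul1r expr2.
  - by exists (fun j => v j 0 ord0), (fun=> 1) => c c1;
      rewrite expr0 expr1 -oneE.
  - by exists (fun j => v j 0 ord0), (fun j => v j 0 (lift ord0 ord0)) => c c1;
      rewrite !expr1.
  - by exists (fun j => v j 0 ord0), (fun j => v j 0 ord0) => c c1;
      rewrite expr0 mulr1 expr2.
eexists; eexists => c c1; rewrite big_cons lk// IH// bquad_mul.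
by rewrite -[bquad a b c]mul1r -bquad_lin.
Qed.

Lemma P2_bary v f : P2 (triangle v) f -> exists a b, bary_eq v f a b.
Proof.
move=> [p [p3 fp]]; have [a [b pE]] := mpoly_bquad v p3.
by exists a, b => c c0 c1; rewrite -pE// fp// inE; exists c.
Qed.

Lemma eqOn_bary v f g a b : bary_eq v f a b -> bary_eq v g a b ->
  eqOn (triangle v) f g.
Proof. by move=> fE gE x /set_mem[c [c0 c1 ->]]; rewrite fE// gE. Qed.

(** If x = sum c_i v_i with sum c_i = 1, then x - v_0 = (c_1, c_2) M, where the rows of M are the
    edge vectors at v_0. Nondegeneracy makes M invertible, hence c_1 and c_2 are affine in x, and so
    is c_0 = 1 - c_1 - c_2. *)
Lemma barycentric_mpoly v : nondegenerate_triangle v ->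
  exists l : 'I_3 -> mpoly 2 R, (forall i, msize (l i) <= 2)%N /\
    forall c, \sum_i c i = 1 -> forall i,
      evalrV (l i) (\sum_j c j *: v j) = c i.
Proof.
rewrite /nondegenerate_triangle => free.
pose M : 'M[R]_2 := col_mx (v 1 - v 0) (v 2%:R - v 0).
have uM : M \in unitmx by rewrite -row_free_unit.
pose q (j : 'I_2) : mpoly 2 R :=
  \sum_k invmx M k j *: (mpolyX R (mnm1 k) - mpolyC 2 (v 0 0 k)).
have sq j : (msize (q j) <= 2)%N.
  apply: (leq_trans (msize_sum _ _ _)); apply/bigmax_leqP => k _.
  apply: (leq_trans (msizeZ_le _ _)); apply: (leq_trans (msizeD_le _ _)).
  by rewrite geq_max msizeN msizeX mdeg1/= msizeC; case: eqP.
have qE c j : \sum_i c i = 1 ->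
    evalrV (q j) (\sum_i c i *: v i) = if j == 0 then c 1 else c 2%:R.
  move=> c1; rewrite /evalrV /q raddf_sum/=.
  pose d : 'rV[R]_2 := row_mx (c 1)%:M (c 2%:R)%:M.
  have dM : \sum_i c i *: v i - v 0 = d *m M.
    transitivity ((c 1)%:M *m (v 1 - v 0) + (c 2%:R)%:M *m (v 2%:R - v 0));
      last by rewrite -mul_row_col.
    rewrite !mul_scalar_mx.
    move: c1; rewrite !(sum3E _ 0) !add0r => c1.
    (* Replacing v_0 by (c_0 + c_1 + c_2) v_0 makes the identity homogeneous in c. *)
    rewrite -[X in _ - X]scale1r -c1 !scalerBr !scalerDl !opprD.
    rewrite !addrA; apply/rowP => k; rewrite !mxE; ring.
  transitivity ((d *m M *m invmx M) 0 j).
    rewrite -dM mxE; apply: eq_bigr => k _.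
    by rewrite mevalZ mevalB mevalXU mevalC !mxE mulrC.
  rewrite mulmxK// /d; case: j => [[|[|//]] j2].
    have -> : Ordinal j2 = @lshift 1 1 0 by apply: val_inj.
    by rewrite [LHS](row_mxEl (c 1)%:M (c 2%:R)%:M 0 0) mxE.
  have -> : Ordinal j2 = @rshift 1 1 0 by apply: val_inj.
  by rewrite [LHS](row_mxEr (c 1)%:M (c 2%:R)%:M 0 0) mxE.
exists (fun i => if i == 0 then 1 - q 0 - q 1 else if i == 1 then q 0 else q 1).
split=> [i|c c1 i].
  case: ifP => _; last by case: ifP.
  rewrite (leq_trans (msizeD_le _ _))// geq_max msizeN sq andbT.
  by rewrite (leq_trans (msizeD_le _ _))// geq_max msizeN sq msize1.
case: ifPn => [/eqP->|i0].
  rewrite /evalrV !mevalB meval1 -!/(evalrV _ _) !qE//=.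
  rewrite -[X in X - _ - _]c1 (sum3E _ 0) !add0r; ring.
case: ifPn => [/eqP->|i1]; rewrite qE//=.
by congr c; apply: val_inj; case: i i0 i1 => [[|[|[|]]]].
Qed.

(** This is the converse of [P2_bary]: the affine polynomials giving the coordinates are substituted
    into the quadratic form. *)
Lemma bary_P2 v a b : nondegenerate_triangle v ->
  exists2 f, P2 (triangle v) f & bary_eq v f a b.
Proof.
move=> /barycentric_mpoly[l [l2 lE]].
pose p : mpoly 2 R :=
  \sum_i (a i *: (l i * l i) + b i *: (l (i + 1) * l (i + 2%:R))).
have lP i j : (msize (l i * l j) <= 3)%N.
  (* The size of a product is the sum of the sizes minus one only for nonzero factors. *)
  have [->|i0] := eqVneq (l i) 0; first by rewrite mul0r msize0.
  have [->|j0] := eqVneq (l j) 0; first by rewrite mulr0 msize0.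
  rewrite msizeM//; by move: (leq_add (l2 i) (l2 j)); case: (_ + _)%N.
exists (evalrV p).
  exists p; split => //.
  apply: (leq_trans (msize_sum _ _ _)); apply/bigmax_leqP => i _.
  rewrite (leq_trans (msizeD_le _ _))// geq_max.
  by rewrite !(leq_trans (msizeZ_le _ _)).
move=> c c0 c1; rewrite /evalrV /p raddf_sum; apply: eq_bigr => i _ /=.
have := lE c c1; rewrite /evalrV => lc.
by rewrite mevalD !mevalZ !mevalM !lc.
Qed.

End Barycentric.

(** * The fundamental theorem of calculus with a derivative on the open interval only *)

Section OpenFTC.
Variable R : realType.
Local Notation mu := (@lebesgue_measure R).
Implicit Types (H h : R -> R) (a b : R).

(** Continuity of h is asked inside only, because the weights may be unbounded near the endpoints.
    The indefinite integral of h minus H is continuous up to the endpoints with zero derivative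
    inside, so by the mean value theorem it takes equal values at a and b. *)
Lemma Rintegral_FTC2_oo H h a b : a < b ->
  mu.-integrable `[a, b] (EFin \o h) ->
  {in `]a, b[, continuous h} ->
  {within `[a, b], continuous H} ->
  (forall x, x \in `]a, b[ -> is_derive x (1 : R) H (h x)) ->
  \int[mu]_(x in `[a, b]) h x = H b - H a.
Proof.
move=> ab ih ch cH dH.
pose G := fun x => parameterized_integral mu a x h.
have dG x : x \in `]a, b[ -> is_derive x (1 : R) G (h x).
  move=> xab; have xb : x < b by rewrite (itvP xab).
  have ax : a < x by rewrite (itvP xab).
  have [dGx GE] := continuous_FTC1_closed xb ih ax (ch _ xab).
  by apply: DeriveDef; [exact: dGx|rewrite -derive1E; exact: GE].
have dD x : x \in `]a, b[ -> is_derive x (1 : R) (G \- H) ((cst 0 : R -> R) x).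
  move=> xab; have := dG _ xab; have := dH _ xab => ? ?.
  by apply: is_derive_eq; rewrite subrr.
have cD : {within `[a, b], continuous (G \- H)}.
  move=> x; apply: cvgB; last exact: cH.
  exact: (parameterized_integral_continuous (ltW ab) ih).
have [c _] := MVT ab dD cD.
rewrite mul0r /= /G /parameterized_integral set_itv1 Rintegral_set1.
by lra.
Qed.

(* Monotone convergence along the segments [a + e, b - e]. *)
Lemma ge0_integrable_derive_oo H h a b : a < b ->
  {in `]a, b[, continuous h} -> (forall x, x \in `]a, b[ -> 0 <= h x) ->
  {within `[a, b], continuous H} ->
  (forall x, x \in `]a, b[ -> is_derive x (1 : R) H (h x)) ->
  mu.-integrable `[a, b] (EFin \o h).
Proof.
move=> ab ch h0 cH dH.
have mh : measurable_fun `]a, b[ h.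
  apply: open_continuous_measurable_fun; first exact: interval_open.
  by move=> x /set_mem; exact: ch.
have mhc : measurable_fun `[a, b] h.
  by apply/measurable_fun_itv_bndo_bndcP/measurable_fun_itv_obnd_cbndP.
(* A bound M of |H| bounds the integral of h over every inner segment by 2M. *)
have [M HM] : exists M : R, forall x, x \in `[a, b] -> `|H x| <= M.
  have [c _ cM] := EVT_max (ltW ab) cH.
  have [d _ dM] := EVT_min (ltW ab) cH.
  exists (`|H c| + `|H d|) => x xab; have := cM _ xab; have := dM _ xab.
  have := ler_norm (H c); have := ler_norm (- H d); rewrite normrN.
  have := normr_ge0 (H c); have := normr_ge0 (H d).
  by rewrite ler_norml => *; apply/andP; split; lra.
(* Starting at 3 keeps e n at most a third of the length, so that every segment [a + e n, b - e n]
   is nondegenerate. *)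
pose e n := (b - a) / n.+3%:R.
have e0 n : 0 < e n by rewrite divr_gt0// subr_gt0.
have e3 n : e n <= (b - a) / 3%:R.
  by rewrite ler_wpM2l ?subr_ge0 ?(ltW ab)// lef_pV2 ?posrE// ler_nat.
have sE n x : a + e n <= x -> x <= b - e n -> x \in `]a, b[.
  by move=> x1 x2; rewrite in_itv/=; have := e0 n => ?; apply/andP; split; lra.
pose E n := [set` `[a + e n, b - e n]].
have subE n : E n `<=` [set` `]a, b[].
  by move=> x /=; rewrite in_itv/= => /andP[? ?]; exact: (sE n).
have ndE : nondecreasing_seq E.
  move=> m n mn; rewrite subsetEset => x; rewrite /E /= !in_itv/= => /andP[? ?].
  have : e n <= e m.
    by rewrite ler_wpM2l ?subr_ge0 ?(ltW ab)// lef_pV2 ?posrE// ler_nat.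
  by move=> ?; apply/andP; split; lra.
have EU : \bigcup_n E n = [set` `]a, b[].
  apply/seteqP; split=> [x [n _]|x]; first exact: subE.
  rewrite /= in_itv/= => /andP[ax xb].
  pose d := Num.min (x - a) (b - x).
  have d0 : 0 < d by rewrite lt_min !subr_gt0 ax.
  have [N hN] : exists N : nat, (b - a) / d < N%:R.
    by exists (Num.trunc ((b - a) / d)).+1; rewrite truncnS_gt.
  have ed : e N <= d.
    rewrite ler_pdivrMr// mulrC -ler_pdivrMr//.
    by rewrite (le_trans (ltW hN))// ler_nat -addn3 leq_addr.
  have : d <= x - a /\ d <= b - x by rewrite !ge_min !lexx orbT.
  move=> [d1 d2]; exists N => //; rewrite /E/= in_itv/=.
  by apply/andP; split; lra.
have IE n : (\int[mu]_(x in E n) (h x)%:E <= (2 * M)%:E)%E.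
  have En : a + e n < b - e n by have := e3 n; lra.
  have iE : mu.-integrable (E n) (EFin \o h).
    apply: continuous_compact_integrable; first exact: segment_compact.
    apply: continuous_in_subspaceT => x /set_mem /subE; exact: ch.
  have cHn : {within E n, continuous H}.
    apply: continuous_subspaceW cH => x /subE; exact: subset_itv_oo_cc.
  have subEn x : x \in `]a + e n, b - e n[ -> x \in `]a, b[.
    by rewrite in_itv/= => /andP[? ?]; apply: (sE n); apply: ltW.
  have IntE := @Rintegral_FTC2_oo H h _ _ En iE (fun x xE => ch x (subEn x xE))
    cHn (fun x xE => dH x (subEn x xE)).
  rewrite -[leLHS]fineK; last first.
    exact: (@integrable_fin_num _ _ _ mu (E n) (measurable_itv _) _ iE).
  move: IntE; rewrite /Rintegral -/(E n) => ->.
  have eab x : a + e n <= x -> x <= b - e n -> x \in `[a, b].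
    by move=> x1 x2; apply: subset_itv_oo_cc; exact: (sE n).
  have := HM _ (eab _ (lexx _) (ltW En)).
  have := HM _ (eab _ (ltW En) (lexx _)).
  rewrite lee_fin !ler_norml => /andP[? ?] /andP[? ?]; lra.
apply/integrableP; split; first exact/measurable_EFinP.
rewrite -integral_itv_bndo_bndc; last first.
  apply/measurable_EFinP/measurableT_comp => //.
  by apply/measurable_fun_itv_bndo_bndcP.
rewrite -integral_itv_obnd_cbnd; last exact/measurable_EFinP/measurableT_comp.
rewrite (@le_lt_trans _ _ (2 * M)%:E) ?ltry//.
have -> : (\int[mu]_(x in `]a, b[) `|(EFin \o h) x| =
    \int[mu]_(x in `]a, b[) (EFin \o h) x)%E.
  apply: eq_integral => x /set_mem xab.
  by congr EFin; rewrite ger0_norm// h0.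
rewrite -EU.
have mE n : measurable (E n : set (measurableTypeR R)) by exact: measurable_itv.
have cvgI := @ge0_nondecreasing_set_cvg_integral _ (measurableTypeR R) R E
  (EFin \o h) mu ndE mE.
apply: (closed_cvg (fun y => y <= (2 * M)%:E)%E _ _ _ (cvgI _ _)).
- exact: closed_ereal_ge_ereal.
- by apply: nearW => n; exact: IE.
- by move=> n; apply/measurable_EFinP; apply: measurable_funS mh.
- by move=> n x /subE xab; rewrite lee_fin h0.
Qed.

End OpenFTC.

(** * Integrability and quadratic moments of the weight *)

Section Moments.
Variable R : realType.
Local Notation mu := (@lebesgue_measure R).
Implicit Types (a q t : R).

Lemma weight_ge0 a t : 0 <= weight a t.
Proof. by rewrite mulr_ge0// powR_ge0. Qed.

Lemma powRS (x a : R) : 0 < x -> x `^ (a + 1) = x `^ a * x.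
Proof.
by move=> x0; rewrite powRD ?powRr1 ?(ltW x0)// (gt_eqF x0) implybT.
Qed.

Lemma weightS a t : t \in `]0, 1[ ->
  weight (a + 1) t = weight a t * (t * (1 - t)).
Proof.
rewrite in_itv/= => /andP[t0 t1]; rewrite /weight.
have s0 : 0 < 1 - t by lra.
by rewrite !powRS//; ring.
Qed.

(** The exponent is a + 1 so that the derivative is a multiple of [weight a], the function to be
    integrated. *)
Lemma is_derive_weight a t : t \in `]0, 1[ ->
  is_derive t (1 : R) (weight (a + 1))
    ((a + 1) * (weight a t * (1 - 2%:R * t))).
Proof.
move=> t01; have := t01; rewrite in_itv/= => /andP[t0 t1].
have s0 : 0 < 1 - t by lra.
have dP := @is_derive1_powR R (a + 1) _ t0.
have dS := @is_derive1_powR R (a + 1) _ s0.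
have dC : is_derive t (1 : R) (fun s => (1 - s) `^ (a + 1))
    (((a + 1) * (1 - t) `^ (a + 1 - 1)) * (0 - 1)).
  exact: (@is_derive1_comp _ (fun x => x `^ (a + 1)) (fun s => 1 - s)).
have := is_deriveM dP dC; rewrite /weight.
set D1 := (X in is_derive _ _ _ X -> _).
set D2 := (X in _ -> is_derive _ _ _ X).
suff -> : D1 = D2 by [].
by rewrite /D1 /D2 addrK !powRS// /GRing.scale/=; ring.
Qed.

Lemma continuous_weight a : {in `]0, 1[, continuous (weight a)}.
Proof.
(* Since a = (a - 1) + 1, differentiability gives continuity for any exponent. *)
move=> t /(@is_derive_weight (a - 1) t); rewrite subrK => -[dw _].
exact/differentiable_continuous/derivable1_diffP.
Qed.

Lemma within_continuous_weight q : 0 < q ->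
  {within `[0, 1], continuous (weight q)}.
Proof.
move=> q0; have w0 : weight q 0 = 0 by rewrite /weight powR0 ?mul0r// gt_eqF.
have w1 : weight q 1 = 0 by rewrite /weight subrr powR0 ?mulr0// gt_eqF.
have cp : {for 1, continuous (fun x : R => x `^ q)}.
  apply/differentiable_continuous/derivable1_diffP/derivable_powR.
  by rewrite in_itv/= ltr01.
apply/continuous_within_itvP => //; split; first exact: continuous_weight.
  rewrite w0 -[X in _ --> X](mul0r ((1 - 0) `^ q)).
  apply: cvgM; first exact: powR_cvg0.
  apply: cvg_at_right_filter.
  apply: (@continuous_comp _ _ _ (fun t => 1 - t) (fun x => x `^ q)).
    by apply: cvgB; [exact: cvg_cst|exact: cvg_id].
  by rewrite subr0.
rewrite w1 -[X in _ --> X](mulr0 (1 `^ q)).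
apply: cvgM.
  by apply: cvg_at_left_filter; exact: cp.
(* As t tends to 1 from the left, 1 - t tends to 0 from the right, where the power tends to 0. *)
apply: (@cvg_comp _ _ _ (fun t => 1 - t) (fun x => x `^ q) _ (0^'+)).
  move=> P [e /= e0 eP]; exists e => // t /= te t1.
  by apply: eP; rewrite ?subr_gt0//= sub0r normrN.
exact: powR_cvg0.
Qed.

Lemma weight_le1 q t : 0 <= q -> t \in `[0, 1] -> weight q t <= 1.
Proof.
rewrite in_itv/= => q0 /andP[t0 t1].
have le1 (x : R) : 0 <= x -> x <= 1 -> x `^ q <= 1.
  move=> x0 x1; rewrite [leRHS](_ : _ = 1 `^ q); last by rewrite powR1.
  by rewrite ge0_ler_powR ?nnegrE.
by rewrite -[leRHS]mulr1 ler_pM ?powR_ge0 ?le1//; lra.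
Qed.

Lemma measurable_weight a : measurable_fun [set` `[0 : R, 1]] (weight a).
Proof.
apply/measurable_fun_itv_bndo_bndcP/measurable_fun_itv_obnd_cbndP.
apply: open_continuous_measurable_fun; first exact: interval_open.
by move=> x /set_mem; exact: continuous_weight.
Qed.

(* With u = t(1-t) and q = a + 1,
   (d/dt) [(2t - 1) u^q] = 2 u^q - q u^a (1 - 4u):
   up to a bounded function this is - q w, which makes w integrable, and the
   integral of this derivative gives momAB. *)
Let wprim a : R -> R := fun t => (2%:R * t - 1) * weight (a + 1) t.

Let is_derive_wprim a t : t \in `]0, 1[ ->
  is_derive t (1 : R) (wprim a) (weight a t *
    (2%:R * (t * (1 - t)) - (a + 1) * (1 - 2%:R * t) ^+ 2)).
Proof.
move=> t01; have dw := is_derive_weight a t01.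
have dl : is_derive t (1 : R) (fun s => 2%:R * s - 1) 2%:R.
  by apply: is_derive_eq; rewrite /GRing.scale/=; ring.
have := is_deriveM dl dw; rewrite /wprim.
set D1 := (X in is_derive _ _ _ X -> _).
set D2 := (X in _ -> is_derive _ _ _ X).
suff -> : D1 = D2 by [].
by rewrite /D1 /D2 weightS// /GRing.scale/=; ring.
Qed.

Let continuous_wprim a : -1 < a -> {within `[0, 1], continuous (wprim a)}.
Proof.
move=> a1; have cl : {within `[0, 1], continuous (fun t : R => 2%:R * t - 1)}.
  apply: continuous_subspaceT => y; apply: cvgB; last exact: cvg_cst.
  by apply: cvgM; [exact: cvg_cst|exact: cvg_id].
move=> x; apply: cvgM; first exact: cl.
by apply: within_continuous_weight; lra.
Qed.

(** The weight is dominated by h / (a + 1), where h is nonnegative with a continuous primitive on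
    [0, 1], hence integrable. *)
Lemma integrable_weight a : -1 < a -> mu.-integrable `[0, 1] (EFin \o weight a).
Proof.
(* With u = t(1 - t), the derivative of - [wprim a] is (a + 1) w - (4a + 6) w u. As w u is at most 1
   and 4a + 6 > 0, adding k = 4a + 6 gives a function above (a + 1) w. *)
move=> a1; pose k : R := 4%:R * a + 6%:R.
pose h := fun t : R => - (weight a t *
    (2%:R * (t * (1 - t)) - (a + 1) * (1 - 2%:R * t) ^+ 2)) + k.
have wu t : t \in `[0, 1] -> weight a t * (t * (1 - t)) <= 1.
  move=> t01; have := t01; rewrite in_itv/= => /andP[t0 t1].
  (* [weightS] covers the open interval only; at the endpoints t(1 - t) vanishes. *)
  have [->|t0'] := eqVneq t 0; first by rewrite mul0r mulr0.
  have [->|t1'] := eqVneq t 1; first by rewrite subrr !mulr0.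
  have ti : t \in `]0, 1[ by rewrite in_itv/= !lt_neqAle t0 t1 eq_sym t0' t1'.
  by rewrite -weightS// weight_le1//; lra.
have hw t : t \in `[0, 1] -> (a + 1) * weight a t <= h t.
  move=> /wu; rewrite /h /k; set w := weight a t => wt.
  suff : 0 <= (4%:R * a + 6%:R) * (1 - w * (t * (1 - t))) by lra.
  by rewrite mulr_ge0; lra.
have ih : mu.-integrable `[0, 1] (EFin \o h).
  apply: (@ge0_integrable_derive_oo _ (fun t => - wprim a t + k * t)).
  - exact: ltr01.
  - move=> t t01; apply: cvgD; last exact: cvg_cst.
    apply: cvgN; apply: cvgM; first exact: continuous_weight.
    apply: cvgB; apply: cvgM; try exact: cvg_cst.
      apply: cvgM; first exact: cvg_id.
      by apply: cvgB; [exact: cvg_cst|exact: cvg_id].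
    by apply: cvgM; apply: cvgB; try exact: cvg_cst;
      apply: cvgM; [exact: cvg_cst|exact: cvg_id|exact: cvg_cst|exact: cvg_id].
  - move=> t t01; apply: le_trans (hw t _); last exact: subset_itv_oo_cc.
    by rewrite mulr_ge0 ?weight_ge0//; lra.
  - have cl : {within `[0, 1], continuous (fun t : R => k * t)}.
      apply: continuous_subspaceT => y.
      by apply: cvgM; [exact: cvg_cst|exact: cvg_id].
    move=> x; apply: cvgD; last exact: cl.
    by apply: cvgN; exact: continuous_wprim.
  - move=> t t01; have dH := is_derive_wprim a t01.
    have dl : is_derive t (1 : R) (fun s => k * s) k.
      by apply: is_derive_eq; rewrite /GRing.scale/=; ring.
    exact: is_deriveD (is_deriveN dH) dl.
apply: (@le_integrable _ _ _ mu _ _ _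
  (fun t => ((a + 1)^-1)%:E * (EFin \o h) t)%E).
- exact: measurable_itv.
- by apply/measurable_EFinP; exact: measurable_weight.
- move=> t t01 /=; rewrite lee_fin ger0_norm ?weight_ge0//.
  apply: le_trans (ler_norm _).
  by rewrite mulrC ler_pdivlMr 1?mulrC ?hw//; lra.
- by apply: integrableZl => //; exact: measurable_itv.
Qed.

Lemma integrable_weightM a (f : R -> R) : -1 < a -> continuous f ->
  mu.-integrable `[0, 1] (EFin \o (fun t => weight a t * f t)).
Proof.
move=> a1 cf.
have -> : EFin \o (fun t => weight a t * f t) =
    ((EFin \o weight a) \* (EFin \o f))%E.
  by apply/funext => t /=; rewrite EFinM.
apply: integrableMl; first exact: measurable_itv.
- exact: integrable_weight.
- apply: measurable_funS (continuous_measurable_fun cf) => //.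
- have cI : compact [set f t | t in `[0, 1]].
    apply: continuous_compact; last exact: segment_compact.
    exact: continuous_subspaceT.
  have [M [Mr MP]] := compact_bounded cI.
  by exists M; split=> // x Mx t t01; apply: (MP x Mx); exists t.
Qed.

(** These two moments are the Beta values Beta(a + 3, a + 1) and Beta(a + 2, a + 2). For general a
    only their ratio and the sign of the second enter the proof. *)
Definition momA a : R := \int[mu]_(t in `[0, 1]) (weight a t * t ^+ 2).
Definition momB a : R := \int[mu]_(t in `[0, 1]) (weight a t * (t * (1 - t))).

Let cid : continuous (fun t : R => t). Proof. by move=> t; exact: cvg_id. Qed.
Let cdif : continuous (fun t : R => 1 - t).
Proof. by move=> t; apply: cvgB; [exact: cvg_cst|exact: cvg_id]. Qed.
Let csq (f : R -> R) : continuous f -> continuous (fun t => f t ^+ 2).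
Proof. by move=> cf t; apply: cvgM; exact: cf. Qed.
Let cprod : continuous (fun t : R => t * (1 - t)).
Proof. by move=> t; apply: cvgM; [exact: cvg_id|exact: cdif]. Qed.

Let integrableZr (k : R) (f : R -> R) : mu.-integrable `[0, 1] (EFin \o f) ->
  mu.-integrable `[0, 1] (EFin \o (fun t => k * f t)).
Proof.
move=> fi; have -> : EFin \o (fun t => k * f t) =
    (fun t => k%:E * (EFin \o f) t)%E.
  by apply/funext => t; rewrite /= EFinM.
by apply: integrableZl fi; exact: measurable_itv.
Qed.

Let integrableDr (f g : R -> R) : mu.-integrable `[0, 1] (EFin \o f) ->
  mu.-integrable `[0, 1] (EFin \o g) ->
  mu.-integrable `[0, 1] (EFin \o (fun t => f t + g t)).
Proof.
move=> fi gi; have -> : EFin \o (fun t => f t + g t) =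
    ((EFin \o f) \+ (EFin \o g))%E.
  by apply/funext => t; rewrite /= EFinD.
by apply: integrableD fi gi; exact: measurable_itv.
Qed.

Let Rintegral_weight_quad0 a (k l m : R) : -1 < a ->
  \int[mu]_(t in `[0, 1])
    (weight a t * (k * t ^+ 2 + l * (t * (1 - t)) + m * (1 - t) ^+ 2)) =
  k * momA a + l * momB a +
  m * \int[mu]_(t in `[0, 1]) (weight a t * (1 - t) ^+ 2).
Proof.
move=> a1.
have i1 := integrable_weightM a1 (csq cid).
have i2 := integrable_weightM a1 cprod.
have i3 := integrable_weightM a1 (csq cdif).
have mI : measurable ([set` `[0, 1]] : set (measurableTypeR R)).
  exact: measurable_itv.
rewrite /momA /momB -(RintegralZl k mI i1) -(RintegralZl l mI i2).
rewrite -(RintegralZl m mI i3).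
rewrite -(RintegralD mI (integrableZr k i1) (integrableZr l i2)).
rewrite -(RintegralD mI _ (integrableZr m i3)).
  by apply: eq_Rintegral => t _; ring.
exact: integrableDr (integrableZr k i1) (integrableZr l i2).
Qed.

Let continuous_quad (k l m : R) :
  continuous (fun t => k * t ^+ 2 + l * (t * (1 - t)) + m * (1 - t) ^+ 2).
Proof.
move=> t; apply: cvgD; first apply: cvgD; (apply: cvgM; first exact: cvg_cst).
- exact: (csq cid).
- exact: cprod.
- exact: (csq cdif).
Qed.

(** Each primitive with equal values at 0 and 1 yields a linear relation between the three quadratic
    moments; two such primitives give the symmetry and [momAB]. *)
Let FTC_weight_quad a (H : R -> R) (k l m : R) : -1 < a ->
  {within `[0, 1], continuous H} -> H 0 = H 1 ->
  (forall t, t \in `]0, 1[ -> is_derive t (1 : R) H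
    (weight a t * (k * t ^+ 2 + l * (t * (1 - t)) + m * (1 - t) ^+ 2))) ->
  k * momA a + l * momB a +
    m * \int[mu]_(t in `[0, 1]) (weight a t * (1 - t) ^+ 2) = 0.
Proof.
move=> a1 cH H01 dH; rewrite -Rintegral_weight_quad0//.
rewrite (@Rintegral_FTC2_oo _ H _ 0 1 ltr01 _ _ cH dH) ?H01 ?subrr//.
  exact: (integrable_weightM a1 (@continuous_quad k l m)).
move=> t t01; apply: cvgM; first exact: continuous_weight.
exact: continuous_quad.
Qed.

Let weight01 a : -1 < a -> weight (a + 1) 0 = 0 /\ weight (a + 1) 1 = 0.
Proof.
by move=> a1; rewrite /weight subrr powR0 ?mul0r ?mulr0// gt_eqF; lra.
Qed.

(** Since 1 - 2t = (1 - t)^2 - t^2, the derivative of [weight (a + 1)] is (a + 1) w ((1 - t)^2 -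
    t^2), and this primitive vanishes at both ends. *)
Lemma Rintegral_weight_sym a : -1 < a ->
  \int[mu]_(t in `[0, 1]) (weight a t * (1 - t) ^+ 2) = momA a.
Proof.
move=> a1; have [w0 w1] := weight01 a1.
have a0 : 0 < a + 1 by lra.
have AB := @FTC_weight_quad a (weight (a + 1)) (- (a + 1)) 0 (a + 1) a1
  (within_continuous_weight a0) (etrans w0 (esym w1)).
have a0' : a + 1 != 0 by rewrite gt_eqF.
apply: (mulfI a0'); suff : - (a + 1) * momA a + 0 * momB a +
    (a + 1) * \int[mu]_(t in `[0, 1]) (weight a t * (1 - t) ^+ 2) = 0 by lra.
apply: AB => t t01; have dw := is_derive_weight a t01.
by apply: is_derive_eq; ring.
Qed.

Lemma Rintegral_weight_quad a (k l m : R) : -1 < a ->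
  \int[mu]_(t in `[0, 1])
    (weight a t * (k * t ^+ 2 + l * (t * (1 - t)) + m * (1 - t) ^+ 2)) =
  (k + m) * momA a + l * momB a.
Proof.
by move=> a1; rewrite Rintegral_weight_quad0// Rintegral_weight_sym//; ring.
Qed.

(** Expanding (1 - 2t)^2 = t^2 - 2t(1 - t) + (1 - t)^2 in the derivative of [wprim a] gives the
    coefficients - (a + 1), 2(a + 2), - (a + 1); its integral is zero. *)
Lemma momAB a : -1 < a -> (a + 2%:R) * momB a = (a + 1) * momA a.
Proof.
move=> a1; have [w0 w1] := weight01 a1.
have H01 : wprim a 0 = wprim a 1 by rewrite /wprim w0 w1 !mulr0.
have := @FTC_weight_quad a (wprim a) (- (a + 1)) (2%:R * (a + 2%:R)) (- (a + 1)) a1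
  (continuous_wprim a1) H01.
rewrite Rintegral_weight_sym// => AB.
suff : - (a + 1) * momA a + 2%:R * (a + 2%:R) * momB a + - (a + 1) * momA a = 0.
  by lra.
apply: AB => t t01; have dH := is_derive_wprim a t01.
by apply: is_derive_eq; ring.
Qed.

Lemma momB_gt0 a : -1 < a -> 0 < momB a.
Proof.
move=> a1; pose q := a + 1; have q0 : 0 <= q by rewrite /q; lra.
(* On [1/4, 1/2] both t and 1 - t are at least 1/4, so the integrand, which equals [weight q], is at
   least c. *)
pose c : R := 4%:R^-1 `^ q * 4%:R^-1 `^ q.
have c0 : 0 < c by rewrite mulr_gt0// powR_gt0.
have iB := integrable_weightM a1 cprod.
have mI : measurable ([set` `[0, 1]] : set (measurableTypeR R)).
  exact: measurable_itv.
have mJ : measurable ([set` `[4%:R^-1, 2%:R^-1]] : set (measurableTypeR R)).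
  exact: measurable_itv.
have subJ : [set` `[4%:R^-1, 2%:R^-1]] `<=` [set` `[0 : R, 1]].
  by move=> t /=; rewrite !in_itv/= => /andP[? ?]; apply/andP; split; lra.
have ge0 t : [set` `[0 : R, 1]] t -> (0 <= (weight a t * (t * (1 - t)))%:E)%E.
  rewrite /= in_itv/= => /andP[t0 t1].
  by rewrite lee_fin mulr_ge0 ?weight_ge0// mulr_ge0//; lra.
suff : (0 < \int[mu]_(t in `[0%R, 1%R]) (weight a t * (t * (1 - t)))%:E)%E.
  rewrite -[X in (0 < X)%E]fineK; last first.
    exact: (@integrable_fin_num _ _ _ mu _ mI _ iB).
  by rewrite lte_fin.
apply: (@lt_le_trans _ _ (\int[mu]_(t in `[4%:R^-1%R, 2%:R^-1%R])
    (cst c%:E) t)%E).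
  rewrite integral_cst//= lebesgue_measure_itv/= lte_fin ifT; last by lra.
  by rewrite -EFinB -EFinM lte_fin mulr_gt0//; lra.
apply: (@le_trans _ _ (\int[mu]_(t in `[4%:R^-1%R, 2%:R^-1%R])
    (weight a t * (t * (1 - t)))%:E)%E).
  apply: ge0_le_integral => //.
  - by move=> t _; rewrite lee_fin ltW.
  - exact: (measurable_funS mI subJ (measurable_int _ iB)).
  - move=> t /=; rewrite in_itv/= => /andP[t0 t1].
    have ti : t \in `]0, 1[ by rewrite in_itv/=; apply/andP; split; lra.
    rewrite lee_fin -weightS//.
    by rewrite ler_pM ?powR_ge0// ge0_ler_powR ?nnegrE//; lra.
apply: ge0_subset_integral => //.
exact: (measurable_int _ iB).
Qed.

End Moments.

(** * The circulant linear system for the six coefficients *)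

Definition crI {F : fieldType} (a b : 'I_3 -> F) (j : 'I_3) : F :=
  (a (j + 1) + a (j + 2%:R)) / 3%:R + b j / 6%:R.

Definition enrF {F : fieldType} (A B : F) (a b : 'I_3 -> F) (j : 'I_3) : F :=
  A * (a j + (a (j + 1) + a (j + 2%:R) + b j) / 4%:R) +
  B * ((b (j + 1) + b (j + 2%:R)) / 2%:R).

Section System.
Variables (F : realFieldType) (A B : F).

Lemma crI_enrF_surj (x y : 'I_3 -> F) :
  8%:R * B - A != 0 -> 4%:R * B - 5%:R * A != 0 ->
  exists a b, forall j, crI a b j = x j /\ enrF A B a b j = y j.
Proof.
move=> D1 D2; pose X := \sum_i x i; pose Y := \sum_i y i.
pose d1 := (8%:R * B - A) / 12%:R; pose d2 := (4%:R * B - 5%:R * A) / 24%:R.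
(* S and T are the sums of the a_j and of the b_j, by Cramer's rule from 2S/3 + T/6 = X and 3AS/2 +
   (A/4 + B)T = Y, of determinant d1. *)
pose S := ((A / 4%:R + B) * X - Y / 6%:R) / d1.
pose T := (2%:R / 3%:R * Y - 3%:R / 2%:R * A * X) / d1.
pose x' j := x j - S / 3%:R; pose y' j := y j - A * S / 4%:R - B * T / 2%:R.
(* Once S and T are known, a_j and b_j solve a 2 x 2 system of determinant d2: - a_j/3 + b_j/6 =
   x'_j and 3A a_j/4 + (A/4 - B/2) b_j = y'_j. *)
exists (fun j => ((A / 4%:R - B / 2%:R) * x' j - y' j / 6%:R) / d2).
exists (fun j => (- y' j / 3%:R - 3%:R / 4%:R * A * x' j) / d2).
move=> j; rewrite /crI /enrF /x' /y' /S /T /X /Y !(sum3E _ j) /d1 /d2.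
by split; field; rewrite D1 D2.
Qed.

Lemma crI_enrF_inj (a b a' b' : 'I_3 -> F) :
  8%:R * B - A != 0 -> 4%:R * B - 5%:R * A != 0 ->
  (forall j, crI a b j = crI a' b' j) ->
  (forall j, enrF A B a b j = enrF A B a' b' j) ->
  forall j, a j = a' j /\ b j = b' j.
Proof.
move=> D1 D2 eI eF j.
have := eI j; have := eI (j + 1); have := eI (j + 2%:R).
have := eF j; have := eF (j + 1); have := eF (j + 2%:R).
rewrite /crI /enrF; have [-> -> -> ->] := shift3 j.
(* Writing each unknown as its primed counterpart plus a difference makes the system homogeneous in
   the differences u and w. *)
have -> : a j = a' j + (a j - a' j) by ring.
have -> : b j = b' j + (b j - b' j) by ring.
have -> : a (j + 1) = a' (j + 1) + (a (j + 1) - a' (j + 1)) by ring.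
have -> : b (j + 1) = b' (j + 1) + (b (j + 1) - b' (j + 1)) by ring.
have -> : a (j + 2%:R) = a' (j + 2%:R) + (a (j + 2%:R) - a' (j + 2%:R)) by ring.
have -> : b (j + 2%:R) = b' (j + 2%:R) + (b (j + 2%:R) - b' (j + 2%:R)) by ring.
move: (a j - _) (a (j + 1) - _) (a (j + 2%:R) - _) => u0 u1 u2.
move: (b j - _) (b (j + 1) - _) (b (j + 2%:R) - _) => w0 w1 w2.
move=> F2 F1 F0 I2 I1 I0.
have W0 : w0 = - 2%:R * (u1 + u2) by lra.
have W1 : w1 = - 2%:R * (u2 + u0) by lra.
have W2 : w2 = - 2%:R * (u0 + u1) by lra.
rewrite {}W0 {}W1 {}W2 {I0 I1 I2} in F0 F1 F2 *.
(* The edge equations have eliminated w. Summing the three median equations isolates the sum of the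
   u's; once it is zero, the equation of index j involves u0 alone. *)
have /eqP : (8%:R * B - A) * (u0 + u1 + u2) = 0 by lra.
rewrite mulf_eq0 (negbTE D1) /= => /eqP S0.
have U12 : u1 + u2 = - u0 by lra.
have /eqP : (4%:R * B - 5%:R * A) * u0 = 0.
  have U2 : u2 = - u0 - u1 by lra.
  by rewrite U2 in F0; lra.
rewrite mulf_eq0 (negbTE D2) /= => /eqP U0.
by rewrite U12 U0 oppr0 mulr0 !addr0.
Qed.

End System.

(** * The functionals in barycentric coordinates and the dual basis *)

Lemma shift3_neq (j : 'I_3) :
  [/\ (j + 1 == j) = false, (j + 2%:R == j) = false
    & (j + 2%:R == j + 1) = false].
Proof. by case: j => [[|[|[|]]]]. Qed.

Section Functionals.
Variable R : realType.
Local Notation mu := (@lebesgue_measure R).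
Implicit Types (v : 'I_3 -> 'rV[R]_2) (f : 'rV[R]_2 -> R) (a b : 'I_3 -> R).

Lemma bary_eq_median v f a b j (t s : R) : bary_eq v f a b ->
  0 <= t -> 0 <= s -> t + s + s = 1 ->
  f (t *: v j + s *: (v (j + 1) + v (j + 2%:R))) =
  a j * t ^+ 2 + (a (j + 1) + a (j + 2%:R) + b j) * s ^+ 2
  + (b (j + 1) + b (j + 2%:R)) * (t * s).
Proof.
move=> fE t0 s0 ts1; have [n1 n2 n3] := shift3_neq j.
pose c i := if i == j then t else s.
have -> : t *: v j + s *: (v (j + 1) + v (j + 2%:R)) = \sum_i c i *: v i.
  by rewrite (sum3E _ j) /c eqxx n1 n2 scalerDr addrA.
rewrite fE; first by rewrite (bquadE _ _ _ j) /c eqxx n1 n2; ring.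
  by move=> i; rewrite /c; case: ifP.
by rewrite (sum3E _ j) /c eqxx n1 n2.
Qed.

Lemma bary_eq_edge v f a b j (t s : R) : bary_eq v f a b ->
  0 <= t -> 0 <= s -> t + s = 1 ->
  f (t *: v (j + 1) + s *: v (j + 2%:R)) =
  a (j + 1) * t ^+ 2 + a (j + 2%:R) * s ^+ 2 + b j * (t * s).
Proof.
move=> fE t0 s0 ts1; have [n1 n2 n3] := shift3_neq j.
pose c i := if i == j then 0 else if i == j + 1 then t else s.
have -> : t *: v (j + 1) + s *: v (j + 2%:R) = \sum_i c i *: v i.
  by rewrite (sum3E _ j) /c !eqxx n1 n2 n3 scale0r add0r.
rewrite fE; first by rewrite (bquadE _ _ _ j) /c !eqxx n1 n2 n3; ring.
  by move=> i; rewrite /c; case: ifP => //; case: ifP.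
by rewrite (sum3E _ j) /c !eqxx n1 n2 n3 add0r.
Qed.

Lemma F_enr_bary v f a b (alpha : R) j : -1 < alpha -> bary_eq v f a b ->
  F_enr v alpha j f = enrF (momA alpha) (momB alpha) a b j.
Proof.
move=> al fE; rewrite /F_enr /enrF.
transitivity (\int[mu]_(t in `[0, 1]) (weight alpha t * (a j * t ^+ 2 +
    ((b (j + 1) + b (j + 2%:R)) / 2%:R) * (t * (1 - t)) +
    ((a (j + 1) + a (j + 2%:R) + b j) / 4%:R) * (1 - t) ^+ 2))); last first.
  by rewrite Rintegral_weight_quad//; ring.
apply: eq_Rintegral => t /set_mem; rewrite /= in_itv/= => /andP[t0 t1].
(* On the median both coordinates other than the j-th equal s = (1 - t)/2, whence the factors 1/4
   and 1/2. *)
congr (_ * _); rewrite /midpoint scalerA (@bary_eq_median _ _ a b)//; last by lra.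
  by field.
by rewrite mulr_ge0//; lra.
Qed.

(* The edge integral is the case alpha = 0 of the moments: A = 1/3, B = 1/6. *)
Lemma I_CR_bary v f a b j : bary_eq v f a b -> I_CR v j f = crI a b j.
Proof.
move=> fE; rewrite /I_CR /crI.
have o1 : -1 < 0 :> R by lra.
have [mA mB] : momA (0 : R) = 3%:R^-1 /\ momB (0 : R) = 6%:R^-1.
  (* For alpha = 0 the weight is 1: integrating (t + (1 - t))^2 = 1 gives 2A + 2B = 1, and [momAB]
     gives 2B = A. *)
  have := momAB o1.
  have := Rintegral_weight_quad 1 2%:R 1 o1.
  have -> : \int[mu]_(t in `[0, 1]) (weight 0 t * (1 * t ^+ 2 +
      2%:R * (t * (1 - t)) + 1 * (1 - t) ^+ 2)) =
      \int[mu]_(t in `[0, 1]) cst 1 t.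
    by apply: eq_Rintegral => t _; rewrite /weight !powRr0 /=; ring.
  rewrite Rintegral_cst//= lebesgue_measure_itv/= lte_fin ltr01 /= => m1 m2.
  by split; lra.
transitivity (\int[mu]_(t in `[0, 1]) (weight 0 t * (a (j + 1) * t ^+ 2 +
    b j * (t * (1 - t)) + a (j + 2%:R) * (1 - t) ^+ 2))); last first.
  by rewrite Rintegral_weight_quad// mA mB.
apply: eq_Rintegral => t /set_mem; rewrite /= in_itv/= => /andP[t0 t1].
rewrite (@bary_eq_edge _ _ a b)//; [|lra..].
by rewrite /weight !powRr0; ring.
Qed.

Lemma bary_eq_comb v (psi zeta : 'I_3 -> 'rV[R]_2 -> R)
    (pa pb za zb : 'I_3 -> 'I_3 -> R) (x y : 'I_3 -> R) :
  (forall i, bary_eq v (psi i) (pa i) (pb i)) ->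
  (forall i, bary_eq v (zeta i) (za i) (zb i)) ->
  bary_eq v (comb psi zeta x y)
    (fun k => \sum_i (x i * pa i k + y i * za i k))
    (fun k => \sum_i (x i * pb i k + y i * zb i k)).
Proof.
move=> pE zE c c0 c1; rewrite /comb.
under eq_bigr do rewrite pE// zE//.
rewrite !(sum3E _ 0) !(bquadE _ _ _ 0) !(sum3E _ 0); ring.
Qed.

Lemma crI_comb (pa pb za zb : 'I_3 -> 'I_3 -> R) (x y : 'I_3 -> R) j :
  crI (fun k => \sum_i (x i * pa i k + y i * za i k))
    (fun k => \sum_i (x i * pb i k + y i * zb i k)) j =
  \sum_i (x i * crI (pa i) (pb i) j + y i * crI (za i) (zb i) j).
Proof. by rewrite /crI !(sum3E _ 0); ring. Qed.

Lemma enrF_comb A B (pa pb za zb : 'I_3 -> 'I_3 -> R) (x y : 'I_3 -> R) j :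
  enrF A B (fun k => \sum_i (x i * pa i k + y i * za i k))
    (fun k => \sum_i (x i * pb i k + y i * zb i k)) j =
  \sum_i (x i * enrF A B (pa i) (pb i) j + y i * enrF A B (za i) (zb i) j).
Proof. by rewrite /enrF !(sum3E _ 0); ring. Qed.

Lemma dets_neq0 (alpha : R) : -1 < alpha -> alpha != - (6%:R / 7%:R) ->
  8%:R * momB alpha - momA alpha != 0 /\
  4%:R * momB alpha - 5%:R * momA alpha != 0.
Proof.
move=> a1 a67; have AB := momAB a1; have B0 := momB_gt0 a1.
split; apply/eqP => E; move: a67; apply/negP; rewrite negbK.
  have AE : momA alpha = 8%:R * momB alpha by lra.
  have : (7%:R * alpha + 6%:R) * momB alpha = 0 by rewrite AE in AB; lra.
  by move=> /eqP; rewrite mulf_eq0 (gt_eqF B0) orbF => /eqP ?; apply/eqP; lra.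
(* A zero of the second determinant would force alpha = -6, which is below -1. *)
have : (alpha + 6%:R) * momB alpha = 0.
  have -> : momB alpha = 5%:R / 4%:R * momA alpha by lra.
  have A4 : momA alpha = 4%:R / 5%:R * momB alpha by lra.
  by rewrite A4 in AB *; lra.
by move=> /eqP; rewrite mulf_eq0 (gt_eqF B0) orbF => /eqP ?; lra.
Qed.

Lemma eqOn_bary_eq v f g a b : eqOn (triangle v) f g -> bary_eq v g a b ->
  bary_eq v f a b.
Proof. by move=> fg gE c c0 c1; rewrite -gE// fg// inE; exists c. Qed.

(* The functionals see an element of P_2(T) only through its barycentric
   coefficients, hence are linear there. *)
Lemma functionals_comb v (psi zeta : 'I_3 -> 'rV[R]_2 -> R) (alpha : R)
    (x y : 'I_3 -> R) : -1 < alpha ->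
  (forall i, P2 (triangle v) (psi i) /\ P2 (triangle v) (zeta i)) ->
  (forall i j, [/\ I_CR v j (psi i) = (i == j)%:R, F_enr v alpha j (psi i) = 0,
        I_CR v j (zeta i) = 0 & F_enr v alpha j (zeta i) = (i == j)%:R]) ->
  forall f, eqOn (triangle v) f (comb psi zeta x y) -> forall j,
    I_CR v j f = x j /\ F_enr v alpha j f = y j.
Proof.
move=> al PP dual f fE j.
have /choice[pa /choice[pb pE]] i := P2_bary (PP i).1.
have /choice[za /choice[zb zE]] i := P2_bary (PP i).2.
have fE' := eqOn_bary_eq fE (bary_eq_comb x y pE zE).
rewrite (I_CR_bary _ fE') (F_enr_bary _ al fE').
rewrite crI_comb enrF_comb.
split.
  rewrite (bigD1 j)//= big1 => [|i ij].
    rewrite -(I_CR_bary _ (pE j)) -(I_CR_bary _ (zE j)).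
    by have [-> _ -> _] := dual j j; rewrite eqxx mulr1 mulr0 !addr0.
  rewrite -(I_CR_bary _ (pE i)) -(I_CR_bary _ (zE i)).
  by have [-> _ -> _] := dual i j; rewrite (negbTE ij) !mulr0 addr0.
rewrite (bigD1 j)//= big1 => [|i ij].
  rewrite -(F_enr_bary _ al (pE j)) -(F_enr_bary _ al (zE j)).
  by have [_ -> _ ->] := dual j j; rewrite eqxx mulr1 mulr0 add0r addr0.
rewrite -(F_enr_bary _ al (pE i)) -(F_enr_bary _ al (zE i)).
by have [_ -> _ ->] := dual i j; rewrite (negbTE ij) !mulr0 addr0.
Qed.

Lemma P2_comb v (psi zeta : 'I_3 -> 'rV[R]_2 -> R) x y :
  (forall i, P2 (triangle v) (psi i) /\ P2 (triangle v) (zeta i)) ->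
  P2 (triangle v) (comb psi zeta x y).
Proof.
move=> PP.
have /choice[p pP] i := (PP i).1; have /choice[q qP] i := (PP i).2.
exists (\sum_i (x i *: p i + y i *: q i)); split.
  apply: (leq_trans (msize_sum _ _ _)); apply/bigmax_leqP => i _.
  rewrite (leq_trans (msizeD_le _ _))// geq_max.
  by rewrite !(leq_trans (msizeZ_le _ _))// ?(pP i).1 ?(qP i).1.
move=> z zT; rewrite raddf_sum /comb; apply: eq_bigr => i _ /=.
by rewrite mevalD !mevalZ (pP i).2// (qP i).2.
Qed.

(** Surjectivity of the system provides the dual families. Duality gives independence, and
    injectivity gives spanning: f and the combination weighted by its functionals have the same
    coefficients. *)
Lemma basis_functions_exist v (alpha : R) : nondegenerate_triangle v ->
  -1 < alpha -> alpha != - (6%:R / 7%:R) ->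
  exists psi zeta, is_basis_functions v alpha psi zeta.
Proof.
move=> vT al al67; have [D1 D2] := dets_neq0 al al67.
have surj x y := crI_enrF_surj x y D1 D2.
have /choice[pa /choice[pb pE]] i := surj (fun j => (i == j)%:R) (fun=> 0).
have /choice[za /choice[zb zE]] i := surj (fun=> 0) (fun j => (i == j)%:R).
have /choice[psi psiP] i : exists f,
    P2 (triangle v) f /\ bary_eq v f (pa i) (pb i).
  by have [f] := bary_P2 (pa i) (pb i) vT; exists f.
have /choice[zeta zetaP] i : exists f,
    P2 (triangle v) f /\ bary_eq v f (za i) (zb i).
  by have [f] := bary_P2 (za i) (zb i) vT; exists f.
have PP i : P2 (triangle v) (psi i) /\ P2 (triangle v) (zeta i).
  by have [] := psiP i; have [] := zetaP i.
have dual i j : [/\ I_CR v j (psi i) = (i == j)%:R, F_enr v alpha j (psi i) = 0,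
    I_CR v j (zeta i) = 0 & F_enr v alpha j (zeta i) = (i == j)%:R].
  have [_ bp] := psiP i; have [_ bz] := zetaP i.
  rewrite !(I_CR_bary _ bp, F_enr_bary _ al bp).
  rewrite !(I_CR_bary _ bz, F_enr_bary _ al bz).
  by have [-> ->] := pE i j; have [-> ->] := zE i j.
have comb_vals x y f := @functionals_comb v psi zeta alpha x y al PP dual f.
exists psi, zeta; split=> //; split=> // [x y xy0 i|f /P2_bary[a [b fE]]].
  (* The zero function is the combination with coefficients x, y and also the one with zero
     coefficients; its functionals read off both. *)
  have [<- <-] : I_CR v i (fun=> 0) = x i /\ F_enr v alpha i (fun=> 0) = y i.
    by apply: comb_vals => z zT; rewrite xy0.
  apply: (comb_vals (fun=> 0) (fun=> 0)) => z zT.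
  by rewrite /comb big1// => j _; rewrite !mul0r addr0.
pose x j := I_CR v j f; pose y j := F_enr v alpha j f.
exists x, y.
have [a' [b' gE]] := P2_bary (P2_comb x y PP).
have gv j := comb_vals x y (comb psi zeta x y) (fun z zT => erefl) j.
have ab : forall j, a j = a' j /\ b j = b' j.
  apply: (crI_enrF_inj D1 D2) => k.
    by rewrite -(I_CR_bary _ gE) -(I_CR_bary _ fE) (gv k).1.
  by rewrite -(F_enr_bary _ al gE) -(F_enr_bary _ al fE) (gv k).2.
apply: eqOn_bary fE _ => c c0 c1; rewrite gE//.
by apply: eq_bigr => i _; have [-> ->] := ab i.
Qed.

End Functionals.

(** * The approximation operator *)

Theorem theorem2p8 (R : realType) (v : 'I_3 -> 'rV[R]_2)
    (hv : nondegenerate_triangle v) (alpha : R)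
    (halpha : -1 < alpha) (halpha' : alpha != - (6%:R / 7%:R)) :
  [/\ (* the operator maps C(T) to P_2(T) *)
      forall f : 'rV[R]_2 -> R, contOn (triangle v) f ->
        P2 (triangle v) (Pi_enr v alpha f),
      forall p : 'rV[R]_2 -> R, P2 (triangle v) p ->
        eqOn (triangle v) (Pi_enr v alpha p) p
    & forall f : 'rV[R]_2 -> R, contOn (triangle v) f ->
        forall j : 'I_3,
          I_CR v j (Pi_enr v alpha f) = I_CR v j f /\
          F_enr v alpha j (Pi_enr v alpha f) = F_enr v alpha j f].
Proof.
have [psi [zeta bE]] := basis_functions_exist hv halpha halpha'.
(* Existence rules out the default value of [xget], so the selected families satisfy their
   characterization. *)
have [[PP _ spanP] dual] :
    is_basis_functions v alpha (psi_enr v alpha) (zeta_enr v alpha).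
  by apply: (@xgetPex _ _ [set b | is_basis_functions v alpha b.1 b.2]);
    exists (psi, zeta).
have vals x y f := @functionals_comb _ v _ _ alpha x y halpha PP dual f.
split=> [f _|p pP|f _ j].
- exact: P2_comb.
(* By duality the coefficients of p in the basis are its functionals, that is, those used by the
   operator. *)
- have [x [y pE]] := spanP p pP.
  move=> z zT; rewrite pE// /Pi_enr /comb; apply: eq_bigr => j _.
  by have [-> ->] := vals x y p pE j.
- exact: (vals _ _ (Pi_enr v alpha f) (fun z _ => erefl)).
Qed.
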